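(* Let $X$ be a Banach space with the Daugavet property. Then, for every $\varepsilon>0$, there exists an equivalent norm $|\cdot|_\varepsilon$ on $X$ such that: (1) $(X,|\cdot|_\varepsilon)$ fails the r-BSP and, in particular, its unit ball contains slices of diameter strictly smaller than $2$ (diameter computed with respect to $|\cdot|_\varepsilon$); (2) $\mathcal T^{cc}((X,|\cdot|_\varepsilon))\geq 2-\varepsilon$.
   Context: All Banach spaces are real. $B_X$ and $S_X$ denote the closed unit ball and the unit sphere of $X$. $X$ has the Daugavet property if every (bounded) rank-one operator $T:X\to X$ satisfies $\|T+I\|=1+\|T\|$, where $I$ is the identity operator. A slice of $B_X$ is a set $\{x\in B_X: x^*(x)>1-\alpha\}$ with $x^*\in S_{X^*}$, $\alpha>0$. A convex combination of slices of $B_X$ is a set $\sum_{i=1}^n\lambda_i S_i$ with $n\in\mathbb N$, $S_i$ slices of $B_X$, $\lambda_i\in[0,1]$, $\sum_{i=1}^n\lambda_i=1$. $B(x,r)$ is the ball of centre $x$ and radius $r$. $X$ has the r-big slice property (r-BSP) if $r(S):=\inf\{r>0: S\subseteq B(x,r)\text{ for some }x\in X\}\geq 1$ for every slice $S$ of $B_X$. Moreover, $\mathcal T^{cc}(X):=\inf\{r>0:\text{ there exist }x\in S_X\text{ and a convex combination of slices }C\text{ of }B_X\text{ such that }C\subset B(x,r)\}$. For $(X,|\cdot|_\varepsilon)$ all these notions are taken with respect to the norm $|\cdot|_\varepsilon$. *)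

(* Defs.v *)
From HB Require Import structures.
From mathcomp Require Import all_boot all_order all_algebra.
From mathcomp Require Import all_classical all_reals all_analysis.

Set Implicit Arguments.
Unset Strict Implicit.
Unset Printing Implicit Defensive.

Import Order.TTheory GRing.Theory Num.Theory.
Import numFieldNormedType.Exports.

Local Open Scope classical_set_scope.
Local Open Scope ring_scope.

(* A type carries only one canonical norm, so the geometric notions below take
   the norm N : X -> R as an explicit parameter; this way they apply both to
   the given norm of X and to renormings of X. Suprema and infima are taken in
   the extended reals: an unbounded operator has norm +oo. *)

Section Norms.
Context {R : realType}.

Definition is_norm (X : lmodType R) (N : X -> R) : Prop :=
  [/\ forall x y, N (x + y) <= N x + N y,
      forall (a : R) x, N (a *: x) = `|a| * N x
    & forall x, N x = 0 -> x = 0].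

Definition equivalent_norm (X : normedModType R) (N : X -> R) : Prop :=
  is_norm N /\
  exists a b : R, [/\ 0 < a, 0 < b &
    forall x : X, a * `|x| <= N x /\ N x <= b * `|x|].

Definition opnorm (U V : lmodType R) (NU : U -> R) (NV : V -> R)
    (T : U -> V) : \bar R :=
  ereal_sup [set (NV (T x))%:E | x in [set x | NU x <= 1]].

Definition rank_one (X : lmodType R) (T : X -> X) : Prop :=
  exists2 v : X, v != 0 & range T = range (fun a : R => a *: v).

Definition daugavet_property (X : normedModType R) : Prop :=
  forall T : {linear X -> X}, continuous T -> rank_one T ->
    let nrm := fun x : X => `|x| in
    opnorm nrm nrm (fun x => T x + x) = (1 + opnorm nrm nrm T)%E.

Section Renorming.
Variables (X : lmodType R) (N : X -> R).

Definition unit_ball : set X := [set x | N x <= 1].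

Definition unit_sphere : set X := [set x | N x = 1].

Definition dual_norm (f : {linear X -> R^o}) : \bar R :=
  opnorm N (fun t : R^o => `|t|) f.

(* No separate continuity hypothesis on f: finiteness of its dual norm is
   boundedness of f. *)
Definition is_slice (S : set X) : Prop :=
  exists (f : {linear X -> R^o}) (alpha : R),
    [/\ dual_norm f = 1%E, 0 < alpha
      & S = [set x | unit_ball x /\ 1 - alpha < f x]].

Definition is_ccs (C : set X) : Prop :=
  exists (n : nat) (lam : 'I_n -> R) (S : 'I_n -> set X),
    [/\ forall i, is_slice (S i),
        forall i, 0 <= lam i <= 1,
        \sum_(i < n) lam i = 1
      & C = [set \sum_(i < n) lam i *: s i
              | s in [set s : 'I_n -> X | forall i, S i (s i)]]].

(* Balls B(x, r) are closed; the infima in the next definition and in Tcc are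
   the same with open balls. *)
Definition radius (S : set X) : \bar R :=
  ereal_inf [set r%:E | r in
    [set r : R | 0 < r /\ exists x : X, S `<=` closed_ball_ N x r]].

Definition diam (S : set X) : \bar R :=
  ereal_sup [set (N (x - y))%:E | x in S & y in S].

Definition r_BSP : Prop := forall S : set X, is_slice S -> (1 <= radius S)%E.

Definition Tcc : \bar R :=
  ereal_inf [set r%:E | r in
    [set r : R | 0 < r /\ exists (x : X) (C : set X),
       [/\ unit_sphere x, is_ccs C & C `<=` closed_ball_ N x r]]].

End Renorming.
End Norms.

(* Main.v *)
(* Fix [x0] with [|x0| = 2d], [d] small, and renorm [X] by the gauge of
   conv(B \cup (x0 + (1 - d) B) \cup (- x0 + (1 - d) B)), where [B] is the
   original unit ball. A functional [f] norming [x0] is larger on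
   [x0 + (1 - d) B] than on the rest, so a thin slice given by [f] is close to
   [x0 + (1 - d) B], a ball of radius [1 - d]. On the other hand the new norm is
   (1 + 2d)-close to the old one, and every slice of the new ball contains a
   translate, by a vector of norm at most [2d], of a slice of a multiple [rho B]
   with [rho >= 1 - d]. In a Daugavet space one may pick points [y_i] in such
   slices one after the other so that [|v + \sum_i lam_i y_i|] is almost
   [|v| + \sum_i lam_i rho_i]; hence no convex combination of slices is
   contained in a ball of radius much smaller than 2 centred at the sphere. *)
Require Import Defs.
From HB Require Import structures.
From mathcomp Require Import all_boot all_order all_algebra.
From mathcomp Require Import all_classical all_reals all_analysis.
From mathcomp Require Import ring lra.
Set Implicit Arguments.
Unset Strict Implicit.
Unset Printing Implicit Defensive.

Import Order.TTheory GRing.Theory Num.Theory.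
Import numFieldNormedType.Exports.
Local Open Scope classical_set_scope.
Local Open Scope ring_scope.

(** * Infima of families of reals indexed by a set *)

Section Infimum.
Context {R : realType} {T : Type}.
Implicit Types (F : T -> R) (A : set T).

Lemma ge_inf_image F A b x :
  (forall y, A y -> b <= F y) -> A x -> inf [set F y | y in A] <= F x.
Proof.
move=> lbF Ax; apply: ge_inf; last by exists x.
by exists b => _ [y Ay <-]; exact: lbF.
Qed.

Lemma le_inf_image F A b x :
  A x -> (forall y, A y -> b <= F y) -> b <= inf [set F y | y in A].
Proof.
move=> Ax lbF; apply: lb_le_inf; first by exists (F x), x.
by move=> _ [y Ay <-]; exact: lbF.
Qed.

Lemma inf_image_lt F A x r :
  A x -> inf [set F y | y in A] < r -> exists2 y, A y & F y < r.
Proof.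
move=> Ax /inf_lt; case; first by exists (F x), x.
by move=> _ [y Ay <-] Fyr; exists y.
Qed.

End Infimum.

(** * Sublinear functionals and the Hahn-Banach theorem *)

Section HahnBanach.
Context {R : realType} {X : lmodType R}.

Definition sublinear (p : X -> R) : Prop :=
  (forall x y, p (x + y) <= p x + p y) /\
  (forall (a : R) x, 0 <= a -> p (a *: x) = a * p x).

Section SublinearTheory.
Variable p : X -> R.
Hypothesis sub_p : sublinear p.

Lemma sublinear0 : p 0 = 0.
Proof. by rewrite -(scale0r 0) (proj2 sub_p) ?mul0r. Qed.

Lemma sublinear_ge x : - p (- x) <= p x.
Proof. by have := (proj1 sub_p) x (- x); rewrite subrr sublinear0; lra. Qed.

(** The reverse inequality is [qZ] for the scalar [a^-1] at the point [a *: x]. *)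
Lemma sublinear_homog (q : X -> R) :
  (forall (a : R) x, 0 < a -> q (a *: x) <= a * q x) -> q 0 = 0 ->
  forall (a : R) x, 0 <= a -> q (a *: x) = a * q x.
Proof.
move=> qZ q0 a x; rewrite le_eqVlt => /predU1P[<-|a_gt0].
  by rewrite scale0r mul0r.
apply/eqP; rewrite eq_le qZ //=.
have a_neq0 : a != 0 by rewrite gt_eqF.
have := qZ a^-1 (a *: x); rewrite invr_gt0 => /(_ a_gt0).
by rewrite scalerA mulVf // scale1r ler_pdivlMl.
Qed.

(** For sublinear [p], this is the largest sublinear functional below [p] whose value at [- z] is at
    most [- p z]. The linear functionals below it are those dominated by [p] that agree with [p] at
    [z]. *)
Definition tilt (z x : X) : R :=
  inf [set p (x + t *: z) - t * p z | t in [set t : R | 0 <= t]].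

Lemma tilt_lbound z x (t : R) : 0 <= t -> - p (- x) <= p (x + t *: z) - t * p z.
Proof.
move=> t_ge0; have := proj1 sub_p (x + t *: z) (- x).
by rewrite addrAC subrr add0r (proj2 sub_p) //; lra.
Qed.

Lemma tilt_le z x (t : R) : 0 <= t -> tilt z x <= p (x + t *: z) - t * p z.
Proof.
by move=> t_ge0; apply: ge_inf_image => // s; exact: tilt_lbound.
Qed.

Lemma tilt_lt z x r : tilt z x < r ->
  exists2 t : R, 0 <= t & p (x + t *: z) - t * p z < r.
Proof. exact: (inf_image_lt (A := [set t : R | 0 <= t]) (lexx 0)). Qed.

Lemma tilt_le_id z x : tilt z x <= p x.
Proof. by have := @tilt_le z x 0 (lexx _); rewrite scale0r addr0 mul0r subr0. Qed.

Lemma tilt_sublinear z : sublinear (tilt z).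
Proof.
split=> [x y|].
  apply/ler_addgt0Pr => e e_gt0.
  have [|s s_ge0 sx] := @tilt_lt z x (tilt z x + e / 2); first lra.
  have [|t t_ge0 ty] := @tilt_lt z y (tilt z y + e / 2); first lra.
  have := @tilt_le z (x + y) (s + t) (addr_ge0 s_ge0 t_ge0).
  have := proj1 sub_p (x + s *: z) (y + t *: z).
  by rewrite scalerDl addrACA mulrDl; lra.
apply: sublinear_homog.
  move=> a x a_gt0; rewrite -ler_pdivrMl //.
  apply: (@le_inf_image _ _ _ _ _ 0) => //= t t_ge0.
  rewrite ler_pdivrMl // mulrBr -(proj2 sub_p a _ (ltW a_gt0)) scalerDr scalerA mulrA.
  by apply: tilt_le; rewrite mulr_ge0 ?(ltW a_gt0).
apply/eqP; rewrite eq_le -{1}sublinear0 tilt_le_id /=.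
apply: (@le_inf_image _ _ _ _ _ 0) => //= t t_ge0.
by rewrite add0r (proj2 sub_p) // subrr.
Qed.

End SublinearTheory.

(* A minimal [p] equals its tilts, and [tilt p y x <= p (x + y) - p y]. *)
Lemma minimal_sublinear_additive (p : X -> R) :
  sublinear p ->
  (forall q, sublinear q -> (forall x, q x <= p x) -> q = p) ->
  forall x y, p (x + y) = p x + p y.
Proof.
move=> sub_p min_p x y; apply/eqP; rewrite eq_le (proj1 sub_p) /=.
have tilt_p : tilt p y = p.
  by apply: min_p => [|z]; [exact: tilt_sublinear | exact: tilt_le_id].
have := @tilt_le _ sub_p y x 1 ler01.
by rewrite tilt_p scale1r mul1r lerBrDr.
Qed.

Lemma additive_sublinear_linear (p : X -> R) :
  sublinear p -> (forall x y, p (x + y) = p x + p y) ->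
  linear (p : X -> R^o).
Proof.
move=> sub_p pD.
have pN x : p (- x) = - p x.
  by have := pD x (- x); rewrite subrr (sublinear0 sub_p); lra.
move=> a x y; rewrite pD; congr (_ + _).
have [a_ge0|a_lt0] := leP 0 a; first exact: (proj2 sub_p).
rewrite -[a]opprK scaleNr pN (proj2 sub_p); last by rewrite oppr_ge0 ltW.
by rewrite scaleNr.
Qed.

(** Zorn's lemma applies because the pointwise infimum of a chain of sublinear functionals below [p]
    is again sublinear; it is finite since each of them is at least [- p (- x)] at [x]. *)
Lemma minimal_sublinear (p : X -> R) : sublinear p ->
  exists2 q, sublinear q /\ (forall x, q x <= p x) &
    forall q', sublinear q' -> (forall x, q' x <= q x) -> q' = q.
Proof.
move=> sub_p.
pose T := {q : X -> R | sublinear q /\ forall x, q x <= p x}.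
(* The order is reversed, so that maximal elements are pointwise minimal. *)
pose below (q q' : T) : bool := `[< forall x, sval q' x <= sval q x >].
have [||||[q [sub_q qp]] min_q] := @Zorn T below.
- by move=> q; apply/asboolP => x.
- move=> q r s /asboolP qr /asboolP rs; apply/asboolP => x.
  exact: le_trans (rs x) (qr x).
- move=> [q qP] [r rP] /asboolP /= qr /asboolP /= rq.
  by apply: eq_exist; apply/funext => x; apply/eqP; rewrite eq_le qr rq.
- move=> A chainA.
  have [[q0 Aq0]|A0] := pselect (A !=set0); last first.
    exists (exist _ p (conj sub_p (fun x => lexx _))) => q Aq.
    by exfalso; apply: A0; exists q.
  pose m x := inf [set sval q x | q in A].
  have lbm x (q : T) : A q -> - p (- x) <= sval q x.
    case: q => q [sub_q qp] _ /=; have := sublinear_ge sub_q x.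
    by have := qp (- x); lra.
  have m_le x (q : T) : A q -> m x <= sval q x.
    by move=> Aq; apply: (ge_inf_image (F := fun r : T => sval r x)) Aq; exact: lbm.
  have m_lt x r : m x < r -> exists2 q, A q & sval q x < r.
    by move=> /(inf_image_lt (F := fun r : T => sval r x) Aq0).
  have sub_m : sublinear m.
    split=> [x y|].
      apply/ler_addgt0Pr => e e_gt0.
      have [|q Aq qx] := m_lt x (m x + e / 2); first lra.
      have [|r Ar ry] := m_lt y (m y + e / 2); first lra.
      have [/asboolP|/asboolP] := chainA _ _ Aq Ar => qr.
      + have := proj1 (proj1 (svalP r)) x y; have := m_le (x + y) r Ar.
        by have := qr x; lra.
      + have := proj1 (proj1 (svalP q)) x y; have := m_le (x + y) q Aq.
        by have := qr y; lra.
    apply: sublinear_homog.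
      move=> a x a_gt0; rewrite -ler_pdivrMl //.
      apply: (le_inf_image (F := fun r : T => sval r x) Aq0) => q Aq.
      rewrite ler_pdivrMl // -(proj2 (proj1 (svalP q)) a _ (ltW a_gt0)).
      exact: m_le.
    apply/eqP; rewrite eq_le.
    have q00 := sublinear0 (proj1 (svalP q0)).
    rewrite -{1}q00 m_le //=.
    apply: (le_inf_image (F := fun r : T => sval r 0) Aq0) => q Aq.
    by rewrite (sublinear0 (proj1 (svalP q))).
  have mp x : m x <= p x.
    by apply: le_trans (m_le x q0 Aq0) _; exact: (proj2 (svalP q0)).
  exists (exist _ m (conj sub_m mp)) => q Aq; apply/asboolP => x /=.
  exact: m_le.
exists q => // q' sub_q' q'q.
have q'p x : q' x <= p x by exact: le_trans (q'q x) (qp x).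
suff /(congr1 sval) :
  exist _ q' (conj sub_q' q'p) = exist _ q (conj sub_q qp) :> T by [].
by apply: min_q; apply/asboolP.
Qed.

Lemma hahn_banach_dominated (p : X -> R) : sublinear p ->
  exists f : {linear X -> R^o}, forall x, f x <= p x.
Proof.
move=> sub_p; have [q [sub_q qp] min_q] := minimal_sublinear sub_p.
have lin_q := additive_sublinear_linear sub_q
  (minimal_sublinear_additive sub_q min_q).
pose f : {linear X -> R^o} := HB.pack (q : X -> R^o)
  (GRing.isLinear.Build R X R^o *:%R q lin_q).
by exists f.
Qed.

End HahnBanach.

Lemma functionalZ {R : realType} {X : lmodType R} (f : {linear X -> R^o}) (a : R) x :
  f (a *: x) = a * f x.
Proof. exact: linearZ. Qed.

Lemma norming_functional {R : realType} {X : normedModType R} (e : X) :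
  exists2 f : {linear X -> R^o}, forall x, `|f x| <= `|x| & f e = `|e|.
Proof.
(* Tilting the norm by [e] forces [f (- e) <= - |e|]. *)
pose nrm (x : X) : R := `|x|.
have sub_nrm : sublinear nrm.
  split=> [x y|a x a_ge0]; first exact: ler_normD.
  by rewrite /nrm normrZ ger0_norm.
have [f f_le] := hahn_banach_dominated (tilt_sublinear sub_nrm e).
have f_le_norm x : f x <= `|x| by exact: le_trans (f_le x) (tilt_le_id sub_nrm e x).
exists f => [x|].
  rewrite ler_norml f_le_norm andbT.
  by have := f_le_norm (- x); rewrite linearN normrN; lra.
apply/eqP; rewrite eq_le f_le_norm /=.
have := le_trans (f_le (- e)) (tilt_le sub_nrm e (- e) ler01).
by rewrite linearN scale1r addNr /nrm normr0 mul1r sub0r lerN2.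
Qed.

(** * The bounded rank-one operators to which the Daugavet property is applied *)

Section RankOne.
Context {R : realType} {X : normedModType R}.
Variables (f : {linear X -> R^o}) (u : X).

Definition rank_one_op (x : X) : X := f x *: u.

Lemma rank_one_op_linear : linear rank_one_op.
Proof. by move=> a x y; rewrite /rank_one_op linearP scalerDl scalerA. Qed.

HB.instance Definition _ :=
  GRing.isLinear.Build R X X *:%R rank_one_op rank_one_op_linear.

Lemma rank_one_opP x : f x != 0 -> u != 0 -> rank_one rank_one_op.
Proof.
move=> fx_neq0 u_neq0; exists u => //; apply/seteqP; split=> [_ [y _ <-]|_ [a _ <-]].
  by exists (f y).
exists ((a / f x) *: x) => //; rewrite /rank_one_op linearZ.
by congr (_ *: _); exact: mulfVK.
Qed.

Lemma rank_one_op_continuous :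
  (forall x, `|f x| <= `|x|) -> continuous rank_one_op.
Proof.
move=> f_le; apply: bounded_linear_continuous.
apply/linear_boundedP; near=> M => x.
rewrite normrZ mulrC; apply: ler_pM => //; near: M; exact: nbhs_pinfty_ge.
Unshelve. all: by end_near.
Qed.

End RankOne.

(** * Almost additive points in slices of a Daugavet space *)

Section DaugavetSlices.
Context {R : realType} {X : normedModType R}.
Implicit Types (x y u v : X) (f : {linear X -> R^o}).

Lemma polar_decomposition v : (exists x : X, x != 0) ->
  exists2 u, `|u| = 1 & v = `|v| *: u.
Proof.
move=> [x x_neq0].
have normalize (z : X) : z != 0 -> `|(`|z|^-1 *: z)| = 1.
  by move=> z_neq0; rewrite normrZ normfV normr_id mulVf ?normr_eq0.
have [->|v_neq0] := eqVneq v 0.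
  by exists (`|x|^-1 *: x); [exact: normalize | rewrite normr0 scale0r].
exists (`|v|^-1 *: v); first exact: normalize.
by rewrite scalerA mulfV ?normr_eq0 // scale1r.
Qed.

(** If [s <= c], subtract [(c - s) *: u] from [x + c *: u]; otherwise scale by [s / c] and subtract
    [(s / c - 1) *: x]. The triangle inequality controls the loss in both cases. *)
Lemma rescale_almost_additive x u (c s t : R) :
  `|x| <= 1 -> `|u| = 1 -> 0 < c -> 0 <= s -> 0 <= t ->
  1 + c - t <= `|x + c *: u| ->
  1 + s - (1 + s / c) * t <= `|x + s *: u|.
Proof.
move=> x1 u1 c_gt0 s_ge0 t_ge0 xcu.
have sc_ge0 : 0 <= s / c by rewrite divr_ge0 // ltW.
have sct := mulr_ge0 sc_ge0 t_ge0.
have [s_le_c|/ltW c_le_s] := leP s c.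
  have := ler_normD (x + s *: u) ((c - s) *: u).
  rewrite -addrA -scalerDl [s + _]addrC subrK normrZ u1 ger0_norm ?subr_ge0 //; lra.
have sc1 : 1 <= s / c by rewrite ler_pdivlMr // mul1r.
have := ler_normD (x + s *: u) ((s / c - 1) *: x).
have -> : x + s *: u + (s / c - 1) *: x = (s / c) *: (x + c *: u).
  rewrite scalerDr scalerA divfK ?gt_eqF // addrAC; congr (_ + _).
  by rewrite scalerBl scale1r addrC subrK.
rewrite (normrZ (s / c)) (normrZ (s / c - 1)) ger0_norm // ger0_norm ?subr_ge0 //.
have := ler_wpM2l sc_ge0 xcu.
have -> : s / c * (1 + c - t) = s / c + s - s / c * t.
  by field; rewrite gt_eqF.
have : (s / c - 1) * `|x| <= s / c - 1 by rewrite ler_piMr ?subr_ge0.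
lra.
Qed.

(** The operator [rank_one_op f u] has norm [F], the supremum of [|f|] on the unit ball. A point
    nearly attaining the norm [1 + F] of its sum with the identity must also nearly attain [F]. *)
Lemma daugavet_functional f u z (tau : R) :
  daugavet_property X -> (forall x, `|f x| <= `|x|) ->
  `|z| <= 1 -> 0 < f z -> `|u| = 1 -> 0 < tau ->
  exists x, [/\ `|x| <= 1, 0 < f x,
    forall y, `|y| <= 1 -> f y <= f x + tau &
    1 + f x - tau <= `|x + f x *: u|].
Proof.
move=> dauX f_le z1 fz_gt0 u1 tau_gt0.
have u_neq0 : u != 0 by rewrite -normr_eq0 u1 oner_neq0.
have := dauX (rank_one_op f u) (rank_one_op_continuous (u := u) f_le)
  (rank_one_opP (lt0r_neq0 fz_gt0) u_neq0).
cbv zeta; set nrm := fun x : X => `|x|; set K := opnorm nrm nrm (rank_one_op f u).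
move=> dauE.
have normT x : `|rank_one_op f u x| = `|f x| by rewrite normrZ u1 mulr1.
have K_ub x : `|x| <= 1 -> (`|f x|%:E <= K)%E.
  by move=> x1; apply: ereal_sup_ubound; exists x => //; rewrite /nrm normT.
have K_fin : K \is a fin_num.
  rewrite fin_numElt (lt_le_trans (ltNyr `|f z|)) ?K_ub //=.
  apply: (@le_lt_trans _ _ 1%E); last exact: ltry.
  apply: ge_ereal_sup => _ [x /= x1 <-]; rewrite /nrm normT lee_fin.
  exact: le_trans (f_le x) x1.
rewrite -(fineK K_fin) in dauE; set F := fine K in dauE.
have F_ub x : `|x| <= 1 -> `|f x| <= F.
  by move=> x1; rewrite -lee_fin fineK //; exact: K_ub.
have F_gt0 : 0 < F.
  exact: lt_le_trans (lt_le_trans fz_gt0 (ler_norm _)) (F_ub z z1).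
(* The bound [F / 2] keeps [|f x|] away from zero. *)
pose t := Num.min tau (F / 2).
have t_gt0 : 0 < t by rewrite lt_min tau_gt0; lra.
have t_tau : t <= tau by rewrite ge_min lexx.
have t_F : t <= F / 2 by rewrite ge_min lexx orbT.
have : ((1 + F - t)%:E < opnorm nrm nrm (fun x => rank_one_op f u x + x)%R)%E.
  by rewrite dauE lte_fin; lra.
move=> /ereal_sup_gt [_ [x /= x1 <-]]; rewrite lte_fin /nrm => xT.
have fx_big : F - t < `|f x|.
  have := ler_normD (rank_one_op f u x) x; rewrite normT.
  by move: x1; rewrite /nrm; lra.
wlog fx_ge0 : x x1 xT fx_big / 0 <= f x.
  move=> wl; have [|/ltW fx_le0] := leP 0 (f x); first exact: wl.
  apply: (wl (- x)).
  - by rewrite /nrm normrN.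
  - by rewrite linearN -opprD normrN.
  - by rewrite linearN normrN.
  - by rewrite linearN oppr_ge0.
have fx_F := F_ub x x1; rewrite ger0_norm // in fx_big fx_F.
exists x; split=> //; first lra.
  by move=> y y1; have := le_trans (ler_norm _) (F_ub y y1); lra.
by move: xT; rewrite /rank_one_op [f x *: u + x]addrC; lra.
Qed.

(** The Daugavet property yields a point almost additive with [f x *: u], where [u] is the direction
    of [v]; rescaling replaces the length [f x] by [|v|]. *)
Lemma daugavet_slice f (beta : R) y0 v (tau : R) :
  (exists x : X, x != 0) -> daugavet_property X -> (forall x, `|f x| <= `|x|) ->
  `|y0| <= 1 -> beta < f y0 -> 0 < tau ->
  exists y, [/\ `|y| <= 1, beta < f y & 1 + `|v| - tau <= `|v + y|].
Proof.
move=> X_neq0 dauX f_le y01 fy0 tau_gt0.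
have [u u1 vE] := polar_decomposition v X_neq0.
(* For [f = 0] the slice is the whole ball, and [u] itself is a suitable point. *)
have [f0|f_neq0] := pselect (forall x, f x = 0).
  exists u; split; rewrite ?u1 //; first by rewrite f0 -(f0 y0).
  rewrite {2}vE -[X in _ *: _ + X]scale1r -scalerDl normrZ u1 mulr1.
  by rewrite ger0_norm ?addr_ge0 //; lra.
have [z [z1 fz_gt0]] : exists z, `|z| <= 1 /\ 0 < f z.
  have [w fw] : exists w, f w != 0.
    apply: contrapT => fN; apply: f_neq0 => x.
    by apply/eqP/negPn/negP => ?; apply: fN; exists x.
  have w_gt0 : 0 < `|w| by rewrite (lt_le_trans _ (f_le w)) // normr_gt0.
  exists ((Num.sg (f w) / `|w|) *: w); split.
    rewrite normrZ normrM normfV normr_id normr_sg fw.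
    by rewrite mul1r mulVf ?gt_eqF.
  by rewrite functionalZ mulrAC -normrEsg; apply: divr_gt0; rewrite // normr_gt0.
pose m := f z; pose s := `|v|.
have s_ge0 : 0 <= s by exact: normr_ge0.
(* The first bound forces [f x > m / 2], so the rescaling factor is at most [1 + 2 * s / m]; the
   second then keeps the loss below [tau], and the third puts [x] in the slice. Halving makes all
   three strict. *)
pose t := Num.min (Num.min (m / 2) (tau / (1 + 2 * s / m))) (f y0 - beta) / 2.
have sm_gt0 : 0 < 1 + 2 * s / m.
  by rewrite ltr_pwDl // divr_ge0 ?mulr_ge0 // ltW.
have t_gt0 : 0 < t.
  rewrite divr_gt0 // !lt_min subr_gt0 fy0 andbT divr_gt0 //=.
  exact: divr_gt0.
have [t_m t_tau t_beta] : [/\ t < m / 2, t < tau / (1 + 2 * s / m) & t < f y0 - beta].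
  have : t < 2 * t by lra.
  have -> : 2 * t = Num.min (Num.min (m / 2) (tau / (1 + 2 * s / m))) (f y0 - beta).
    by rewrite /t mulrC divfK.
  by rewrite !lt_min => /andP[/andP[? ?] ?]; split.
have [x [x1 fx_gt0 fx_max xu]] := daugavet_functional dauX f_le z1 fz_gt0 u1 t_gt0.
exists x; split=> //; first by have := fx_max y0 y01; lra.
have := rescale_almost_additive x1 u1 fx_gt0 (normr_ge0 v) (ltW t_gt0) xu.
rewrite -vE [x + v]addrC; apply: le_trans; rewrite lerB //.
apply: le_trans (_ : (1 + 2 * s / m) * t <= _); last first.
  by rewrite mulrC -ler_pdivlMr // ltW.
rewrite ler_pM2r // lerD2l ler_pdivrMr // mulrAC ler_pdivlMr //.
rewrite -/s -subr_ge0.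
have -> : 2 * s * f x - s * m = s * (2 * f x - m) by ring.
by rewrite mulr_ge0 ?normr_ge0 //; have := fx_max z z1; rewrite -/m; lra.
Qed.

(** By induction on [n]: the vector built from the other indices serves as the base vector when the
    point of index [ord0] is chosen. *)
Lemma daugavet_slices n (f : 'I_n -> {linear X -> R^o}) (lam rho beta : 'I_n -> R)
    (y0 : 'I_n -> X) v (tau : R) :
  (exists x : X, x != 0) -> daugavet_property X ->
  (forall i x, `|f i x| <= `|x|) -> (forall i, 0 <= lam i) ->
  (forall i, 0 < rho i) ->
  (forall i, `|y0 i| <= rho i /\ beta i < f i (y0 i)) -> 0 < tau ->
  exists y : 'I_n -> X,
    (forall i, `|y i| <= rho i /\ beta i < f i (y i)) /\
    `|v| + \sum_(i < n) lam i * (rho i - tau) <= `|v + \sum_(i < n) lam i *: y i|.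
Proof.
move=> X_neq0 dauX f_le lam_ge0 rho_gt0 hy0 tau_gt0.
elim: n v => [|n IH] v in f lam rho beta y0 f_le lam_ge0 rho_gt0 hy0 *.
  by exists y0; split=> //; rewrite !big_ord0 !addr0.
have [y [hy vy]] := IH v _ (lam \o lift ord0) _ (beta \o lift ord0) _
  (fun i => f_le (lift ord0 i)) (fun i => lam_ge0 _)
  (fun i => rho_gt0 (lift ord0 i)) (fun i => hy0 (lift ord0 i)).
set w := v + _ in vy.
have [z [z_rho fz wz]] : exists z, [/\ `|z| <= rho ord0, beta ord0 < f ord0 z &
    `|w| + lam ord0 * (rho ord0 - tau) <= `|w + lam ord0 *: z|].
  have [y01 fy0] := hy0 ord0; have r_gt0 := rho_gt0 ord0.
  have := lam_ge0 ord0; rewrite le_eqVlt => /predU1P[<-|l_gt0].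
    by exists (y0 ord0); split=> //; rewrite mul0r scale0r !addr0.
  set l := lam ord0 in l_gt0 *; set r := rho ord0 in y01 r_gt0 *.
  (* Everything is divided by [l * r] to reach the unit ball with weight 1; the tolerance [tau / r]
     becomes [l * tau] on scaling back. *)
  have [|||z [z1 fz wz]] := @daugavet_slice (f ord0) (beta ord0 / r)
     (r^-1 *: y0 ord0) ((l * r)^-1 *: w) (tau / r) X_neq0 dauX (f_le ord0).
  - by rewrite normrZ gtr0_norm ?invr_gt0 // ler_pdivrMl // mulr1.
  - by rewrite functionalZ ltr_pdivrMr // mulrAC mulVf ?mul1r ?gt_eqF.
  - exact: divr_gt0.
  exists (r *: z); split.
  - by rewrite normrZ gtr0_norm // ler_piMr // ltW.
  - by rewrite functionalZ mulrC -ltr_pdivrMr.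
  have lr_gt0 : 0 < l * r by exact: mulr_gt0.
  have -> : w + l *: (r *: z) = (l * r) *: ((l * r)^-1 *: w + z).
    by rewrite scalerDr !scalerA mulfV ?gt_eqF // scale1r.
  rewrite normrZ gtr0_norm //; apply: le_trans (ler_wpM2l (ltW lr_gt0) wz).
  rewrite normrZ gtr0_norm ?invr_gt0 // le_eqVlt; apply/orP; left; apply/eqP.
  by field; rewrite !gt_eqF.
exists (fun i => if unlift ord0 i is Some j then y j else z); split.
  move=> i; case: unliftP => [j ->|->]; [exact: hy | by []].
rewrite !big_ord_recl unlift_none.
under [X in _ <= `|_ + (_ + X)|]eq_bigr => i _ do rewrite liftK.
rewrite [lam ord0 *: z + _]addrC [v + _]addrA -/w.
by move: vy wz; rewrite /=; lra.
Qed.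

End DaugavetSlices.

(** * From a small ball containing a slice to failure of the r-BSP *)

Section SlicesAndBalls.
Context {R : realType} {X : lmodType R}.
Variable N : X -> R.
Hypothesis norm_N : is_norm N.

Lemma is_norm_opp x : N (- x) = N x.
Proof. by case: norm_N => _ NZ _; rewrite -scaleN1r NZ normrN1 mul1r. Qed.

Lemma slice_in_small_ball (S : set X) x (r : R) :
  is_slice N S -> 0 < r < 1 -> S `<=` closed_ball_ N x r ->
  ~ r_BSP N /\ (exists S : set X, is_slice N S /\ (diam N S < 2%:E)%E).
Proof.
move=> sliceS /andP[r_gt0 r_lt1] Sball; split.
  move=> /(_ S sliceS); apply/negP; rewrite -ltNge.
  apply: le_lt_trans (_ : (r%:E < 1)%E); last by rewrite lte_fin.
  by apply: ereal_inf_lbound; exists r => //; split=> //; exists x.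
exists S; split=> //; apply: (@le_lt_trans _ _ (2 * r)%:E); last first.
  by rewrite lte_fin; lra.
apply: ge_ereal_sup => _ [y Sy [z Sz <-]]; rewrite lee_fin.
have [NT _ _] := norm_N.
have -> : y - z = - (x - y) + (x - z) by rewrite opprB addrA subrK.
apply: le_trans (NT _ _) _; rewrite is_norm_opp.
by have := Sball y Sy; have := Sball z Sz; rewrite /closed_ball_ /=; lra.
Qed.

End SlicesAndBalls.

(** * The new norm, its small slice and its convex combinations of slices *)

Section Renorming.
Context {R : realType} {X : normedModType R}.
Variables (x0 : X) (d : R).

(** For [r > 0], a cost at most [r] means that [r^-1 *: x] lies in the closed ball of centre
    [(t / r) *: x0] and radius [1 - d * |t / r|], with [|t / r| <= 1]. *)
Definition shift_cost (x : X) (t : R) : R :=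
  Num.max `|t| (`|x - t *: x0| + d * `|t|).

(* The open unit ball of this norm is the union, over [|t| < 1], of the open
   balls of centre [t *: x0] and radius [1 - d * |t|]. *)
Definition renorm (x : X) : R := inf [set shift_cost x t | t in [set: R]].

Hypothesis (d_gt0 : 0 < d) (d_lt1 : d < 1) (normx0 : `|x0| = 2 * d).
Local Notation N := renorm.

Lemma renorm_le x (t r : R) :
  `|t| <= r -> `|x - t *: x0| + d * `|t| <= r -> N x <= r.
Proof.
move=> tr xtr; apply: (@le_trans _ _ (shift_cost x t)).
  apply: (ge_inf_image (F := shift_cost x) (b := 0)) => // s _.
  by rewrite le_max normr_ge0.
by rewrite ge_max tr xtr.
Qed.

Lemma renorm_lt x r : N x < r ->
  exists2 t : R, `|t| < r & `|x - t *: x0| + d * `|t| < r.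
Proof.
move=> /(inf_image_lt (F := shift_cost x) (x := 0) I).
by case=> t _; rewrite gt_max => /andP[? ?]; exists t.
Qed.

Lemma renorm_le_norm x : N x <= `|x|.
Proof.
by apply: (@renorm_le _ 0); rewrite ?normr0 // scale0r subr0 mulr0 addr0.
Qed.

Lemma norm_le_renorm x : `|x| <= (1 + 2 * d) * N x.
Proof.
have [d0 d1] := (d_gt0, d_lt1).
rewrite -ler_pdivrMl; last by lra.
apply/ler_addgt0Pr => e e_gt0; rewrite ler_pdivrMl; last by lra.
have [t tr xtr] := @renorm_lt x (N x + e) (ltr_pwDr e_gt0 (lexx _)).
have := ler_normD (x - t *: x0) (t *: x0); rewrite subrK normrZ normx0.
have dtr := ler_wpM2l (ltW d_gt0) (ltW tr).
have : 0 <= d * `|t| by rewrite mulr_ge0 // ltW.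
lra.
Qed.

Lemma renormD x y : N (x + y) <= N x + N y.
Proof.
have [d0 d1] := (d_gt0, d_lt1).
apply/ler_addgt0Pr => e e_gt0.
have [|s s1 s2] := @renorm_lt x (N x + e / 2); first lra.
have [|t t1 t2] := @renorm_lt y (N y + e / 2); first lra.
have st := ler_normD s t.
apply: (@renorm_le _ (s + t)); first lra.
rewrite scalerDl opprD addrACA.
have := ler_normD (x - s *: x0) (y - t *: x0).
have := ler_wpM2l (ltW d_gt0) st; lra.
Qed.

Lemma renormZ_le (a : R) x : a != 0 -> N (a *: x) <= `|a| * N x.
Proof.
move=> a_neq0; have a_gt0 : 0 < `|a| by rewrite normr_gt0.
rewrite -ler_pdivrMl //; apply/ler_addgt0Pr => e e_gt0; rewrite ler_pdivrMl //.
have [t t1 t2] := @renorm_lt x (N x + e) (ltr_pwDr e_gt0 (lexx _)).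
apply: (@renorm_le _ (a * t)); rewrite normrM; first by rewrite ler_pM2l // ltW.
rewrite -scalerA -scalerBr normrZ mulrCA -mulrDr ler_pM2l //; exact: ltW.
Qed.

Lemma renorm_is_norm : is_norm N.
Proof.
have [d0 d1] := (d_gt0, d_lt1).
split.
- exact: renormD.
- move=> a x; have [->|a_neq0] := eqVneq a 0.
    rewrite scale0r normr0 mul0r; apply/eqP; rewrite eq_le.
    have := norm_le_renorm 0; have := renorm_le_norm 0; rewrite normr0.
    by move=> ->; rewrite pmulr_rge0 //; lra.
  apply/eqP; rewrite eq_le renormZ_le //= -ler_pdivlMl ?normr_gt0 //.
  (* The reverse inequality is the same bound for the scalar [a^-1]. *)
  rewrite -normfV -{1}[x](scalerK a_neq0).
  by apply: renormZ_le; rewrite invr_eq0.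
- move=> x Nx0; apply/eqP; rewrite -normr_le0.
  by have := norm_le_renorm x; rewrite Nx0 mulr0.
Qed.

Lemma renorm_equivalent : equivalent_norm N.
Proof.
have [d0 d1] := (d_gt0, d_lt1).
split; first exact: renorm_is_norm.
exists (1 + 2 * d)^-1, 1; split=> //; first by rewrite invr_gt0; lra.
move=> x; rewrite mul1r; split; last exact: renorm_le_norm.
rewrite ler_pdivrMl; [exact: norm_le_renorm | lra].
Qed.

(** A functional norming [x0] has norm [1 + d] for the new norm, and values close to [1 + d] on the
    new ball force the shift [t] to be close to 1. *)
Lemma norming_slice_in_small_ball :
  exists2 S, is_slice N S & S `<=` closed_ball_ N x0 (1 - d / 2).
Proof.
have [d0 d1] := (d_gt0, d_lt1).
have [f f_le fx0] := norming_functional x0; rewrite normx0 in fx0.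
have f_renorm x : `|f x| <= (1 + d) * N x.
  rewrite -ler_pdivrMl; last by lra.
  apply/ler_addgt0Pr => e e_gt0; rewrite ler_pdivrMl; last by lra.
  have [t tr xtr] := @renorm_lt x (N x + e) (ltr_pwDr e_gt0 (lexx _)).
  have := ler_normD (f (x - t *: x0)) (f (t *: x0)).
  rewrite -linearD subrK functionalZ normrM fx0.
  rewrite [`|2 * d|]ger0_norm; last by lra.
  by have := f_le (x - t *: x0); have := normr_ge0 t; nra.
pose c := (1 + d)^-1.
have c_gt0 : 0 < c by rewrite invr_gt0; lra.
have [g gE] : exists g : {linear X -> R^o}, forall x, g x = c * f x.
  by exists (c \*: f).
have dual_g : dual_norm N g = 1%E.
  apply/eqP; rewrite eq_le; apply/andP; split.
    apply: ge_ereal_sup => _ [x /= x1 <-]; rewrite lee_fin gE normrM gtr0_norm //.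
    rewrite ler_pdivrMl; last by lra.
    by apply: le_trans (f_renorm x) _; rewrite ler_pM2l //; lra.
  (* The norm is attained at the far end, along [x0], of the ball of centre [x0] and radius
     [1 - d]. *)
  apply: ereal_sup_ubound; exists ((1 + (1 - d) / (2 * d)) *: x0) => /=.
    apply: (@renorm_le _ 1); rewrite normr1 // scalerDl addrAC subrr add0r.
    rewrite normrZ normx0 gtr0_norm; last by rewrite divr_gt0 //; lra.
    by rewrite divfK ?mulr1 ?subrK //; apply: lt0r_neq0; lra.
  congr EFin; rewrite gE functionalZ fx0 /c gtr0_norm.
    by field; rewrite lt0r_neq0 //=; apply: lt0r_neq0; lra.
  by rewrite mulr_gt0 // mulr_gt0 ?addr_gt0 ?divr_gt0 //; lra.
exists [set x | unit_ball N x /\ 1 - d / 24 < g x].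
  by exists g, (d / 24); split=> //; lra.
move=> x [/= Nx1]; rewrite gE ltr_pdivlMl; last by lra.
move=> fx; rewrite /closed_ball_ /= -(is_norm_opp renorm_is_norm).
rewrite opprB; apply: le_trans (renorm_le_norm _) _.
have [|t t1 t2] := @renorm_lt x (1 + d / 24).
  by apply: le_lt_trans Nx1 _; lra.
have fxt : f x <= 2 * d * t + `|x - t *: x0|.
  rewrite -{1}(subrK (t *: x0) x) linearD functionalZ fx0.
  by have := le_trans (ler_norm _) (f_le (x - t *: x0)); lra.
have tri : `|x - x0| <= `|x - t *: x0| + `|t - 1| * (2 * d).
  rewrite -normx0 -normrZ scalerBl scale1r.
  by apply: le_trans (ler_normD _ _); rewrite addrA subrK.
have [t_ge0|t_lt0] := leP 0 t; last by rewrite (ltr0_norm t_lt0) in t2; nra.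
rewrite (ger0_norm t_ge0) in t1 t2.
(* The width [d / 24] gives [t > 1 - (2 + d) / 24]; then [|x - x0|] is at most
   [1 + d / 24 - 7 * d / 8 + d / 4], below [1 - d / 2]. *)
have t_big : 7 / 8 < t by nra.
have : `|t - 1| <= 1 / 8 by rewrite ler_norml; apply/andP; split; lra.
by nra.
Qed.

(** A point of the new ball where [f] is nearly maximal lies, after slight shrinking, in one of the
    balls making up the new ball; the part of that ball where [f] is large lies in [S]. *)
Lemma slice_contains_translated_slice (S : set X) : is_slice N S ->
  exists (f : {linear X -> R^o}) (t beta : R) (y0 : X),
    [/\ forall x, `|f x| <= `|x|, `|t| <= 1,
        `|y0| <= 1 - d * `|t| /\ beta < f y0
      & forall y, `|y| <= 1 - d * `|t| -> beta < f y -> S (t *: x0 + y)].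
Proof.
have [d0 d1] := (d_gt0, d_lt1).
move=> [f [alpha [dual_f alpha_gt0 ->]]].
have f_N1 x : N x <= 1 -> `|f x| <= 1.
  by move=> Nx1; rewrite -lee_fin -dual_f; apply: ereal_sup_ubound; exists x.
have f_le x : `|f x| <= `|x|.
  have [->|x_neq0] := eqVneq x 0; first by rewrite linear0 !normr0.
  have x_gt0 : 0 < `|x| by rewrite normr_gt0.
  have := f_N1 (`|x|^-1 *: x).
  rewrite functionalZ normrM normfV normr_id ler_pdivrMl // mulr1.
  apply; apply: le_trans (renorm_le_norm _) _.
  by rewrite normrZ normfV normr_id mulVf ?gt_eqF.
have [x Nx1 fx] : exists2 x, N x <= 1 & 1 - alpha / 2 < f x.
  have : ((1 - alpha / 2)%:E < dual_norm N f)%E by rewrite dual_f lte_fin; lra.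
  move=> /ereal_sup_gt [_ [x /= x1 <-]]; rewrite lte_fin => fx.
  have [fx_ge0|fx_lt0] := leP 0 (f x).
    by exists x => //; rewrite ger0_norm in fx.
  exists (- x); first by rewrite is_norm_opp //; exact: renorm_is_norm.
  by rewrite linearN; rewrite ltr0_norm in fx.
(* Since [(1 - alpha) * c < 1 - alpha / 2], the point [c^-1 *: x] stays in the slice. *)
pose c := 1 + alpha / 2.
have c_gt0 : 0 < c by rewrite /c; lra.
have [|t t1 t2] := @renorm_lt x c; first by rewrite /c; lra.
have tc : `|t / c| = `|t| / c by rewrite normrM normfV (gtr0_norm c_gt0).
(* This [beta] is the level [1 - alpha] of the slice, translated by [(t / c) *: x0]. *)
exists f, (t / c), (1 - alpha - t / c * f x0), (c^-1 *: (x - t *: x0)).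
have t_le1 : `|t / c| <= 1 by rewrite tc ler_pdivrMr // mul1r ltW.
split=> //.
  split.
    rewrite normrZ normfV (gtr0_norm c_gt0) ler_pdivrMl // tc.
    have -> : c * (1 - d * (`|t| / c)) = c - d * `|t| by field; rewrite gt_eqF.
    by lra.
  rewrite [X in _ < X](_ : _ = f x / c - t / c * f x0).
    by rewrite ltrD2r ltr_pdivlMr // /c; nra.
  rewrite (functionalZ f) linearB /= (functionalZ f).
  by field; rewrite gt_eqF.
move=> y y1 fy; split; last by rewrite linearD functionalZ; lra.
apply: (@renorm_le _ (t / c)) => //.
by rewrite addrAC subrr add0r; lra.
Qed.

Lemma Tcc_renorm_ge :
  (exists x : X, x != 0) -> daugavet_property X -> ((2 - 8 * d)%:E <= Tcc N)%E.
Proof.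
have [d0 d1] := (d_gt0, d_lt1).
move=> X_neq0 dauX; apply: le_ereal_inf_tmp.
move=> _ [r [r_gt0 [x [C [Nx1 ccsC Cball]]]] <-]; rewrite lee_fin.
have [n [lam [S [slS lam01 lam1 CE]]]] := ccsC.
have /choice[f /choice[t /choice[beta /choice[y0 H]]]] :=
  fun i => slice_contains_translated_slice (slS i).
have lam_ge0 i : 0 <= lam i by have /andP[] := lam01 i.
have t_le1 i : `|t i| <= 1 by have [] := H i.
have dt_le i : d * `|t i| <= d by rewrite ler_piMr // ltW.
(* The base vector collects the translations of the slices and the centre [x], so that the final sum
   is [z - x]. *)
have [||i|y [hy vy]] := @daugavet_slices _ _ n f lam (fun i => 1 - d * `|t i|) beta y0
  (\sum_(i < n) lam i *: (t i *: x0) - x) d X_neq0 dauX _ lam_ge0 _ _ d_gt0.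
- by move=> i; have [] := H i.
- by move=> i; have := dt_le i; lra.
- by have [] := H i.
pose z := \sum_(i < n) lam i *: (t i *: x0 + y i).
have Cz : C z.
  rewrite CE; exists (fun i => t i *: x0 + y i) => // i.
  by have [_ _ _] := H i; apply; have [] := hy i.
have := Cball z Cz; rewrite /closed_ball_ /= => Nxz.
have zE : `|x - z| =
    `|\sum_(i < n) lam i *: (t i *: x0) - x + \sum_(i < n) lam i *: y i|.
  rewrite -normrN opprB /z; congr `| _ |.
  under eq_bigr do rewrite scalerDr.
  by rewrite big_split /= addrAC.
have sum_ge : 1 - 2 * d <= \sum_(i < n) lam i * (1 - d * `|t i| - d).
  rewrite -[1 - 2 * d]mul1r -{1}lam1 mulr_suml; apply: ler_sum => i _.
  by rewrite ler_wpM2l //; have := dt_le i; lra.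
have shift_le : `|\sum_(i < n) lam i *: (t i *: x0)| <= 2 * d.
  apply: le_trans (ler_norm_sum _ _ _) _.
  rewrite -[2 * d]mul1r -{1}lam1 mulr_suml; apply: ler_sum => i _.
  rewrite !normrZ normx0 ger0_norm // ler_wpM2l // ler_piMl //; lra.
have v_ge : 1 - 2 * d <= `|\sum_(i < n) lam i *: (t i *: x0) - x|.
  rewrite -normrN opprB; apply: le_trans (lerB_dist _ _).
  have := renorm_le_norm x; rewrite (Nx1 : N x = 1); lra.
(* Here [2 - 4 * d <= |x - z| <= (1 + 2 * d) * r], while
   [(2 - 8 * d) * (1 + 2 * d) <= 2 - 4 * d]. *)
have := norm_le_renorm (x - z); rewrite zE.
by have [|] := leP 2 r; nra.
Qed.

End Renorming.

Theorem theorem1p2 (R : realType) (X : completeNormedModType R)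
    (X_neq0 : exists x : X, x != 0) (X_daugavet : daugavet_property X) :
  forall eps : R, 0 < eps ->
    exists N : X -> R,
      [/\ equivalent_norm N,
          ~ r_BSP N /\
          (exists S : set X, is_slice N S /\ (diam N S < 2%:E)%E)
        & ((2 - eps)%:E <= Tcc N)%E].
Proof.
(* The factor 8 matches the bound [2 - 8 * d]; the minimum with 1 ensures [d < 1] for large
   [eps]. *)
move=> eps eps_gt0; pose d := Num.min eps 1 / 8.
have [d_gt0 d_lt1 d_eps] : [/\ 0 < d, d < 1 & 8 * d <= eps].
  have : Num.min eps 1 <= eps by rewrite ge_min lexx.
  have : Num.min eps 1 <= 1 by rewrite ge_min lexx orbT.
  have : 0 < Num.min eps 1 by rewrite lt_min eps_gt0 ltr01.
  by rewrite /d; split; lra.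
have [u u1 _] := polar_decomposition 0 X_neq0.
have normx0 : `|(2 * d) *: u| = 2 * d by rewrite normrZ u1 mulr1 ger0_norm; lra.
exists (renorm ((2 * d) *: u) d); split.
- exact: renorm_equivalent.
- have [S slS Sball] := norming_slice_in_small_ball d_gt0 d_lt1 normx0.
  apply: slice_in_small_ball slS _ Sball; first exact: renorm_is_norm.
  by apply/andP; split; lra.
- apply: le_trans (Tcc_renorm_ge d_gt0 d_lt1 normx0 X_neq0 X_daugavet).
  by rewrite lee_fin; lra.
Qed.
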